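(* If there exist a generalized Hadamard matrix $GH(g,\lambda)$ over a finite abelian group and $f$ mutually UFS Latin squares of order $g\lambda$, then there exists a linked system of $f+1$ symmetric group divisible designs with parameters $(g^3\lambda^2,g^2\lambda^2,g^2\lambda^2,g,0,g\lambda^2)$ and constants $(\sigma,\tau)=((g+g\lambda-1)\lambda,(g\lambda-1)\lambda)$.
   Context: $I_n,J_n$ denote the identity and all-ones matrices of order $n$; $\otimes$ is the Kronecker product. Let $G$ be an additively written abelian group of order $g$. A generalized Hadamard matrix $GH(g,\lambda)$ over $G$ is a square matrix $H=(h_{ij})$ of order $g\lambda$ with entries in $G$ such that for all distinct rows $i,k$ the multiset $\{h_{ij}-h_{kj}:1\le j\le g\lambda\}$ contains each element of $G$ exactly $\lambda$ times. A $v\times v$ $(0,1)$-matrix $A$ ($v=mn$) is the incidence matrix of a symmetric group divisible design with parameters $(v,k,m,n,\lambda_1,\lambda_2)$ if $AA^\top=A^\top A=kI_v+\lambda_1(I_m\otimes J_n-I_v)+\lambda_2(J_v-I_m\otimes J_n)$. A linked system of $r$ such designs with constants $\sigma,\tau$ is a family of such incidence matrices $A_{i,j}$ ($i\neq j$ in $\{1,\ldots,r\}$) with $A_{i,j}^\top=A_{j,i}$ and $A_{i,j}A_{j,l}=\sigma A_{i,l}+\tau(J_v-A_{i,l})$ for all pairwise distinct $i,j,l$. Two Latin squares $L,L'$ of order $N$ on the same symbol set are UFS if for every row $i$ of $L$ and every row $j$ of $L'$ there is exactly one column $a$ with $L(i,a)=L'(j,a)$; a set of Latin squares is mutually UFS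 if every two distinct members are UFS. *)

(* Defs.v *)
From mathcomp Require Import all_boot all_order all_algebra.
From mathcomp Require Export mxtens.

Set Implicit Arguments.
Unset Strict Implicit.
Unset Printing Implicit Defensive.

Import Order.TTheory GRing.Theory Num.Theory.
Local Open Scope ring_scope.

Definition all_ones (n : nat) : 'M[int]_n := const_mx 1.

Definition is_gen_hadamard (g lam : nat) (G : finZmodType)
    (H : 'M[G]_(g * lam)) : Prop :=
  #|G| = g /\
  forall i k : 'I_(g * lam), i != k ->
  forall x : G, #|[set j | H i j - H k j == x]| = lam.

(* [tensmx] indexes rows and columns lexicographically by [i * n + j], as in
   the usual block form of the Kronecker product. *)
Definition group_mx (v m n : nat) (e : v = (m * n)%N) : 'M[int]_v :=
  castmx (esym e, esym e) ((1%:M : 'M[int]_m) *t all_ones n).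

(* All (0,1)-matrices are taken over [int], so that the subtractions in the
   design equations are genuine. *)
Definition is_sgdd (v k m n l1 l2 : nat) (A : 'M[int]_v) : Prop :=
  exists e : v = (m * n)%N,
  let B := k%:Z *: 1%:M + l1%:Z *: (group_mx e - 1%:M)
           + l2%:Z *: (all_ones v - group_mx e) in
  [/\ forall x y, A x y = 0 \/ A x y = 1,
      A *m A^T = B & A^T *m A = B].

(* The diagonal matrices [A i i] are irrelevant placeholders: a linked system
   only involves [A i j] with [i != j]. *)
Definition is_linked_system (r v k m n l1 l2 : nat) (sigma tau : int)
    (A : 'I_r -> 'I_r -> 'M[int]_v) : Prop :=
  [/\ forall i j, i != j -> is_sgdd k m n l1 l2 (A i j),
      forall i j, i != j -> (A i j)^T = A j i &
      forall i j l, i != j -> j != l -> i != l ->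
        A i j *m A j l = sigma *: A i l + tau *: (all_ones v - A i l)].

Definition is_latin (N : nat) (T : finType) (L : 'M[T]_N) : Prop :=
  (forall (i : 'I_N) (t : T), exists! j : 'I_N, L i j = t) /\
  (forall (j : 'I_N) (t : T), exists! i : 'I_N, L i j = t).

Definition ufs (N : nat) (T : finType) (L L' : 'M[T]_N) : Prop :=
  forall i j : 'I_N, exists! a : 'I_N, L i a = L' j a.

Definition mutually_ufs_latin (N : nat) (T : finType)
    (S : {set 'M[T]_N}) : Prop :=
  (forall L, L \in S -> is_latin L) /\
  (forall L L', L \in S -> L' \in S -> L != L' -> ufs L L').

(* Main.v *)
(* From a row [i] of the Hadamard matrix [H] form the block matrix [C_i] whose
   [(j, l)] block is the permutation matrix of [h_il - h_ij].  Then
   [C_i C_i = N C_i], [C_i C_k = lam J] for [i != k], and the [C_i] sum to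
   [N I + lam (J - I (x) J_g)]; the last fact needs the columns of [H] to have
   uniform differences too.  Hence replacing each symbol of a Latin square by
   the corresponding [C_i] gives a symmetric group divisible design.
   Each Latin square is a map [rho i : columns * symbols -> rows]; the first
   projection serves as one more such map, and UFS says that distinct maps are
   orthogonal.  The square [M i j] whose entry at
   [(rho i a t, rho j a t)] is [t] is then well defined, and the squares
   [M i j], [M j l], [M i l] are linked because they come from the same
   cells [(a, t)]. *)
Require Import Defs.
From mathcomp Require Import all_boot all_order all_algebra.
From mathcomp Require Import ring.

Import Order.TTheory GRing.Theory Num.Theory.
Local Open Scope ring_scope.

Set Implicit Arguments.
Unset Strict Implicit.

Lemma sum_indicator (R : pzRingType) (I : finType) (a : I) (F : I -> R) :
  \sum_x (x == a)%:R * F x = F a.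
Proof.
rewrite (bigD1 a) //= eqxx mul1r big1 ?addr0 // => x /negPf->.
by rewrite mul0r.
Qed.

(** * Difference counts of rows and of columns *)

Definition diff_count (G : finZmodType) (N : nat) (H : 'M[G]_N) (i k : 'I_N)
    (x : G) : int :=
  \sum_j (x == H i j - H k j)%:R.

Lemma diff_count_card (G : finZmodType) (N : nat) (H : 'M[G]_N) i k x :
  diff_count H i k x = #|[set j | H i j - H k j == x]|%:R.
Proof.
rewrite /diff_count -sum1_card natr_sum [RHS]big_mkcond /=.
by apply: eq_bigr => j _; rewrite inE eq_sym; case: ifP.
Qed.

Lemma diff_count_diag (G : finZmodType) (N : nat) (H : 'M[G]_N) i x :
  diff_count H i i x = N%:R * (x == 0)%:R.
Proof.
rewrite /diff_count; under eq_bigr do rewrite subrr.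
by rewrite sumr_const card_ord mulr_natl.
Qed.

Definition uniform_differences (G : finZmodType) (N lam : nat)
    (H : 'M[G]_N) : Prop :=
  forall i k, i != k -> forall x, diff_count H i k x = lam%:R.

Lemma sum_diff_count (G : finZmodType) (N : nat) (H : 'M[G]_N) i k :
  \sum_x diff_count H i k x = N%:R.
Proof.
rewrite /diff_count exchange_big /=.
under eq_bigr => j _.
  under eq_bigr => x _ do rewrite -[_%:R]mulr1.
  rewrite sum_indicator; over.
by rewrite sumr_const card_ord.
Qed.

Lemma sum_sqr_diff_count (G : finZmodType) (N : nat) (H : 'M[G]_N) i k :
  \sum_x diff_count H i k x ^+ 2 =
  \sum_j \sum_l (H i j - H k j == H i l - H k l)%:R.
Proof.
under eq_bigr do rewrite expr2 {1}/diff_count mulr_suml.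
rewrite exchange_big /=; apply: eq_bigr => j _.
by rewrite sum_indicator.
Qed.

(** Moving two terms across the equation [H i j - H k j = H i l - H k l] swaps the roles of the row
    pair and the column pair. *)
Lemma sum_sqr_diff_count_tr (G : finZmodType) (N : nat) (H : 'M[G]_N) :
  \sum_i \sum_k \sum_x diff_count H^T i k x ^+ 2 =
  \sum_i \sum_k \sum_x diff_count H i k x ^+ 2.
Proof.
under eq_bigr do under eq_bigr do rewrite sum_sqr_diff_count pair_bigA /=.
under [RHS]eq_bigr do under eq_bigr do rewrite sum_sqr_diff_count pair_bigA /=.
rewrite pair_bigA [RHS]pair_bigA exchange_big /=; apply: eq_bigr => -[i k] _ /=.
apply: eq_bigr => -[j l] _ /=; rewrite !mxE; congr (nat_of_bool _)%:R.
rewrite -subr_eq0 -[RHS]subr_eq0; congr (_ == _).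
by rewrite !opprD addrACA.
Qed.

Lemma sum_dev_diff_count_tr (G : finZmodType) (N : nat) (c : int)
    (H : 'M[G]_N) :
  \sum_i \sum_(k | k != i) \sum_x (diff_count H^T i k x - c) ^+ 2 =
  \sum_i \sum_(k | k != i) \sum_x (diff_count H i k x - c) ^+ 2.
Proof.
(* Expanding the square leaves the second moment as the only term depending on [K]: the counts have
   total [N], and the diagonal counts are known. *)
have total (K : 'M[G]_N) :
    \sum_i \sum_(k | k != i) \sum_x (diff_count K i k x - c) ^+ 2 =
    \sum_i \sum_k \sum_x diff_count K i k x ^+ 2
    + \sum_(i < N) \sum_(k < N) (#|G|%:R * c ^+ 2 - 2 * c * N%:R)
    - \sum_(i < N) \sum_(x : G) (N%:R * (x == 0)%:R - c) ^+ 2.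
  rewrite -big_split /= -sumrB; apply: eq_bigr => i _.
  rewrite -big_split /= [in RHS](bigD1 i) //=.
  have expand k : \sum_x (diff_count K i k x - c) ^+ 2 =
      \sum_x diff_count K i k x ^+ 2 + (#|G|%:R * c ^+ 2 - 2 * c * N%:R).
    rewrite -(sum_diff_count K i k) mulr_sumr mulr_natl -sumr_const -sumrB.
    by rewrite -big_split /=; apply: eq_bigr => x _; ring.
  have diag : \sum_(x : G) (N%:R * (x == 0)%:R - c) ^+ 2 =
      \sum_x (diff_count K i i x - c) ^+ 2.
    by apply: eq_bigr => x _; rewrite diff_count_diag.
  rewrite -expand diag.
  by rewrite addrAC subrr add0r; apply: eq_bigr => k _.
by rewrite !total sum_sqr_diff_count_tr.
Qed.

(* The sum of the squared deviations of the difference counts from [lam] is the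
   same for [H] and [H^T], since up to constants both count the solutions of
   [h i j - h k j = h i l - h k l]. *)
Lemma uniform_differences_tr (G : finZmodType) (N lam : nat) (H : 'M[G]_N) :
  uniform_differences lam H -> uniform_differences lam H^T.
Proof.
move=> rowH i k ik x.
have dev0 : \sum_i \sum_(k | k != i) \sum_x
    (diff_count H^T i k x - lam%:R) ^+ 2 = 0.
  rewrite sum_dev_diff_count_tr; apply: big1 => j _; apply: big1 => l lj.
  by apply: big1 => y _; rewrite rowH ?subrr ?expr0n // eq_sym.
have ge0 j l : 0 <= \sum_y (diff_count H^T j l y - lam%:R) ^+ 2.
  by apply: sumr_ge0 => y _; apply: sqr_ge0.
have ki : k != i by rewrite eq_sym.
have dev0i : \sum_(k | k != i) \sum_y (diff_count H^T i k y - lam%:R) ^+ 2 = 0.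
  by apply: (psumr_eq0P _ dev0) => // j _; apply: sumr_ge0 => l _; apply: ge0.
have dev0ik : \sum_y (diff_count H^T i k y - lam%:R) ^+ 2 = 0.
  by apply: (psumr_eq0P _ dev0i) => // l _; apply: ge0.
apply/eqP; rewrite -subr_eq0 -sqrf_eq0; apply/eqP.
by apply: (psumr_eq0P _ dev0ik) => // y _; apply: sqr_ge0.
Qed.

(** * From UFS Latin squares to linked squares *)

(* [rho i a t] is the row of the [i]-th square whose [a]-th entry is [t]. *)
Definition resolvable_array (r N : nat) (T : finType)
    (rho : 'I_r -> 'I_N -> T -> 'I_N) : Prop :=
  (forall i t, injective (rho i ^~ t)) /\
  (forall i j, i != j ->
     injective (fun p : 'I_N * T => (rho i p.1 p.2, rho j p.1 p.2))).

Lemma latin_card (N : nat) (T : finType) (L : 'M[T]_N) :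
  (0 < N)%N -> is_latin L -> #|T| = N.
Proof.
case: N L => // N L _ [Lrow _].
have inj : injective (L 0).
  move=> j k Ljk; have [j0 [_ uniq]] := Lrow 0 (L 0 j).
  by rewrite -(uniq j erefl) -(uniq k (esym Ljk)).
apply/eqP; rewrite eqn_leq -{2}(card_ord N.+1) (leq_card _ inj) andbT.
have surj t : t \in codom (L 0).
  by have [j [<- _]] := Lrow 0 t; apply: codom_f.
rewrite -[in leqRHS](card_ord N.+1) -(card_codom inj).
by apply: subset_leq_card; apply/subsetP.
Qed.

(* The extra member of the array, with [rho ord0 a t = a], has the columns of
   the Latin squares as its rows. *)
Lemma ufs_resolvable_array (N f : nat) (T : finType) (S : {set 'M[T]_N}) :
  #|S| = f -> mutually_ufs_latin S ->
  exists rho : 'I_f.+1 -> 'I_N -> T -> 'I_N, resolvable_array rho.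
Proof.
move=> cardS [latS ufsS].
pose L (k : 'I_f) : 'M[T]_N := enum_val (cast_ord (esym cardS) k).
have LS k : L k \in S by apply: enum_valP.
have Linj k l : k != l -> L k != L l.
  by apply: contra => /eqP/enum_val_inj/cast_ord_inj->.
(* The default [a] is never reached, since every symbol occurs in every column. *)
pose row k a t := if [pick x | L k x a == t] is Some x then x else a.
have rowP k a t : L k (row k a t) a = t.
  rewrite /row; case: pickP => [x /eqP //|none].
  by have [x [Lx _]] := (latS _ (LS k)).2 a t; move: (none x); rewrite Lx eqxx.
exists (fun i a t => if unlift ord0 i is Some k then row k a t else a).
split=> [i t a b|i j ij [a t] [b s] /=].
  case: unliftP => [k _|//] rab.
  have [c [_ uniq]] := (latS _ (LS k)).1 (row k a t) t.
  by rewrite -(uniq a (rowP k a t)) -(uniq b _) // rab rowP.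
case: unliftP ij => [k|] ->; case: unliftP => [l|] -> // ij [rk rl].
(* The rows [row k a t] and [row l a t] agree in both columns [a] and [b], so UFS forces [a = b]. *)
- have kl : k != l by apply: contra ij => /eqP->.
  have [c [_ uniq]] := ufsS _ _ (LS k) (LS l) (Linj _ _ kl)
    (row k a t) (row l a t).
  have ac : c = a by apply: uniq; rewrite !rowP.
  have bc : c = b by apply: uniq; rewrite rk rl !rowP.
  by rewrite -ac bc -(rowP k b s) -rk -bc ac rowP.
- by rewrite -rl -(rowP k b s) -rk -rl rowP.
- by rewrite -rk -(rowP l b s) -rl -rk rowP.
Qed.

(** The third condition controls a block of [A i j *m A j l]: exactly one summand is a square of
    some [C_t], and this [t] is the entry of [M i l]. *)
Definition linked_squares (r N : nat) (T : finType)
    (M : 'I_r -> 'I_r -> 'I_N -> 'I_N -> T) : Prop :=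
  [/\ forall i j x y, i != j -> M i j x y = M j i y x,
      forall i j x, i != j -> injective (M i j x) &
      forall i j l x z, i != j -> j != l -> i != l -> exists y0,
        M i j x y0 = M i l x z /\
        forall y, (M i j x y == M j l y z) = (y == y0)].

Lemma resolvable_array_linked (r N : nat) (T : finType)
    (rho : 'I_r -> 'I_N -> T -> 'I_N) :
  #|T| = N -> resolvable_array rho ->
  exists M : 'I_r -> 'I_r -> 'I_N -> 'I_N -> T, linked_squares M.
Proof.
move=> cardT [rho_inj rho_orth].
have ex i j x y : i != j -> exists p, rho i p.1 p.2 = x /\ rho j p.1 p.2 = y.
  move=> ij; have [|h _ hK] := inj_card_bij (rho_orth i j ij).
    by rewrite !card_prod card_ord cardT.
  by exists (h (x, y)); have [] := hK (x, y).
(* The default [t0] below needs an inhabited [T]; an empty [T] means [N = 0]. *)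
have [N0|/card_gt0P[t0 _]] := posnP #|T|.
  have no_ord (x : 'I_N) : False by move: (x); rewrite -cardT N0 => -[].
  exists (fun _ _ x _ => False_rect _ (no_ord x)).
  by split=> *; exfalso; apply: no_ord; eassumption.
pose M i j x y :=
  if [pick p : 'I_N * T | (rho i p.1 p.2 == x) && (rho j p.1 p.2 == y)]
  is Some p then p.2 else t0.
have MP i j x y : i != j ->
    exists a, rho i a (M i j x y) = x /\ rho j a (M i j x y) = y.
  move=> ij; rewrite /M; case: pickP => [p /andP[/eqP ? /eqP ?]|none].
    by exists p.1.
  have [p [px py]] := ex i j x y ij.
  by move: (none p); rewrite px py !eqxx.
have ME i j a t : i != j -> M i j (rho i a t) (rho j a t) = t.
  move=> ij; have [b [bi bj]] := MP i j (rho i a t) (rho j a t) ij.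
  suff [] : (b, M i j (rho i a t) (rho j a t)) = (a, t) by [].
  by apply: (rho_orth i j ij); rewrite /= bi bj.
exists M; split=> [i j x y ij|i j x ij y y' Myy'|i j l x z ij jl il].
- have ji : j != i by rewrite eq_sym.
  have [a [ay ax]] := MP j i y x ji.
  by have := ME i j a (M j i y x) ij; rewrite ax ay.
- have [a [ax ay]] := MP i j x y ij; have [b [bx by_]] := MP i j x y' ij.
  have ab : a = b by apply: (rho_inj i (M i j x y)); rewrite /= ax Myy' bx.
  by rewrite -ay -by_ -Myy' ab.
have [a []] := MP i l x z il; set t := M i l x z => ax az.
exists (rho j a t); split=> [|y]; first by rewrite -{1}ax ME.
(* The cells of [(x, y)] and [(y, z)] share their symbol and their [j]-row, so they coincide; this
   cell has the [i]- and [l]-rows of [(a, t)], hence equals it. *)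
apply/eqP/eqP => [Myy|->]; last by rewrite -{1}ax -az !ME.
have [b [bx by_]] := MP i j x y ij; have [c [cy cz]] := MP j l y z jl.
move: cy cz; rewrite -Myy => cy cz.
have cb : c = b by apply: (rho_inj j (M i j x y)); rewrite /= cy by_.
have [ba Mt] : (b, M i j x y) = (a, t).
  by apply: (rho_orth i l il); rewrite /= bx -cb cz ax az.
by rewrite -ba -Mt by_.
Qed.

(** * Block coordinates and block products *)

Lemma group_mx_coord (v m n : nat) (e : v = (m * n)%N) (P Q : finType) :
  #|P| = m -> #|Q| = n ->
  exists phi : 'I_v -> P * Q, bijective phi /\
    forall x y, group_mx e x y = ((phi x).1 == (phi y).1)%:R.
Proof.
move=> cP cQ; pose k x := mxtens_unindex (cast_ord e x).
exists (fun x => (enum_val (cast_ord (esym cP) (k x).1),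
                  enum_val (cast_ord (esym cQ) (k x).2))).
split=> [|x y] /=.
  apply: inj_card_bij; last by rewrite card_prod card_ord cP cQ e.
  move=> x y [] /enum_val_inj/cast_ord_inj k1 /enum_val_inj/cast_ord_inj k2.
  have kxy : k x = k y := congr2 pair k1 k2.
  exact: (@cast_ord_inj _ _ e) (can_inj (@mxtens_unindexK _ _) kxy).
rewrite castmxE !mxE mulr1 (inj_eq enum_val_inj) (inj_eq (@cast_ord_inj _ _ _)).
by rewrite !esymK.
Qed.

(** An index [(x, i, u)] is read as row [x] of the square, block row [i] of [C_t] and element [u] of
    the group. *)
Definition design_entry (G : finZmodType) (N : nat) (H : 'M[G]_N)
    (M : 'I_N -> 'I_N -> 'I_N) (p q : 'I_N * 'I_N * G) : int :=
  let t := M p.1.1 q.1.1 in (q.2 == p.2 + (H t q.1.2 - H t p.1.2))%:R.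

Lemma design_entry_tr (G : finZmodType) (N : nat) (H : 'M[G]_N)
    (M M' : 'I_N -> 'I_N -> 'I_N) p q :
  (forall x y, M x y = M' y x) -> design_entry H M p q = design_entry H M' q p.
Proof.
move=> tr; rewrite /design_entry tr; congr (nat_of_bool _)%:R.
by rewrite -subr_eq eq_sym opprB.
Qed.

(** For fixed [y] the inner sum is an entry of [C_t C_s]. If [t = s], the middle column cancels and
    all [N] terms agree; otherwise the sum is a difference count of rows [t] and [s]. *)
Lemma design_entry_mul (G : finZmodType) (N lam : nat) (H : 'M[G]_N)
    (M M' : 'I_N -> 'I_N -> 'I_N) p r :
  uniform_differences lam H ->
  \sum_q design_entry H M p q * design_entry H M' q r =
  \sum_y (if M p.1.1 y == M' y r.1.1
          then N%:R * (r.2 == p.2 + (H (M p.1.1 y) r.1.2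
                                     - H (M p.1.1 y) p.1.2))%:R
          else lam%:R).
Proof.
case: p r => [[x i] u] [[z l] w] rowH /=.
transitivity (\sum_y \sum_j \sum_v
    design_entry H M (x, i, u) (y, j, v)
    * design_entry H M' (y, j, v) (z, l, w)).
  by rewrite pair_bigA pair_bigA; apply: eq_bigr => -[[]].
apply: eq_bigr => y _; rewrite /design_entry /=.
under eq_bigr do rewrite sum_indicator.
set t := M x y; set s := M' y z.
have [<-|ts] := eqVneq t s.
  under eq_bigr do rewrite -addrA [X in u + X]addrC [X in u + X]addrA subrK.
  by rewrite sumr_const card_ord mulr_natl.
rewrite -(rowH _ _ ts (w - u + H t i - H s l)); apply: eq_bigr => j _.
congr (nat_of_bool _)%:R; rewrite -subr_eq0 -[RHS]subr_eq0; congr (_ == _).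
rewrite !opprD !opprK !addrA; congr (_ + _).
by rewrite (addrAC (w - u)) (addrAC _ (- H t j)).
Qed.

Lemma design_entry_mul_link (G : finZmodType) (N lam : nat) (H : 'M[G]_N)
    (M M' M'' : 'I_N -> 'I_N -> 'I_N) p r y0 :
  uniform_differences lam H ->
  M p.1.1 y0 = M'' p.1.1 r.1.1 ->
  (forall y, (M p.1.1 y == M' y r.1.1) = (y == y0)) ->
  \sum_q design_entry H M p q * design_entry H M' q r =
  N%:R * design_entry H M'' p r + (N%:R - 1) * lam%:R.
Proof.
move=> rowH My0 uniq; rewrite (design_entry_mul _ _ _ _ rowH).
rewrite (bigD1 y0) //= uniq eqxx My0.
congr (_ + _); under eq_bigr => y yy0 do rewrite uniq (negPf yy0).
rewrite sumr_const cardC1 card_ord -[LHS]mulr_natl; congr (_ * _).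
(* The existence of [y0] makes [N] positive, so [N.-1] is a genuine [N - 1]. *)
by case: (N) y0 {My0 uniq} => [[]//|n] _; rewrite -natr1 addrK.
Qed.

Lemma design_entry_mul_tr (G : finZmodType) (N lam : nat) (H : 'M[G]_N)
    (M M' : 'I_N -> 'I_N -> 'I_N) p r :
  uniform_differences lam H ->
  (forall x y, M x y = M' y x) -> (forall x, injective (M x)) ->
  (forall y, injective (M' y)) ->
  \sum_q design_entry H M p q * design_entry H M' q r =
  if p.1 == r.1 then (N * N)%:R * (p == r)%:R else (N * lam)%:R.
Proof.
move=> rowH tr Minj M'inj; rewrite (design_entry_mul _ _ _ _ rowH).
case: p r => [[x i] u] [[z l] w] /=; rewrite xpair_eqE.
have [<-|xz] := eqVneq x z => /=; last first.
  under eq_bigr => y _ do rewrite tr (inj_eq (M'inj y)) (negPf xz).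
  by rewrite sumr_const card_ord -[LHS]mulr_natl natrM.
under eq_bigr => y _ do rewrite tr eqxx -tr.
rewrite -mulr_sumr.
(* As [y] varies, [M x y] runs through all rows of [H], so differences of two columns are
   counted. *)
transitivity (N%:R * diff_count H^T l i (w - u)).
  congr (_ * _); rewrite /diff_count [RHS](reindex_inj (Minj x)) /=.
  apply: eq_bigr => y _; rewrite !mxE.
  by rewrite subr_eq addrC.
have [<-|il] := eqVneq i l; last first.
  by rewrite (uniform_differences_tr rowH) 1?eq_sym // natrM.
rewrite diff_count_diag subr_eq0 natrM -mulrA; congr (_ * (_ * _)).
by rewrite !xpair_eqE !eqxx eq_sym.
Qed.

Lemma exists_linked_squares (N f : nat) (T : finType) (S : {set 'M[T]_N}) :
  #|S| = f -> mutually_ufs_latin S ->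
  exists M : 'I_f.+1 -> 'I_f.+1 -> 'I_N -> 'I_N -> 'I_N, linked_squares M.
Proof.
move=> cardS ufsS.
(* Without a Latin square the size of [T] is unknown, but there is only one index and nothing to
   link. *)
have [f0|/card_gt0P[L LS]] := posnP #|S|.
  exists (fun _ _ x _ => x); move: f0; rewrite cardS => ->.
  by split=> i j; rewrite !ord1 eqxx.
have [->|N_gt0] := posnP N.
  by exists (fun _ _ x _ => x); split=> i j => [[]|[]|l []].
have cardT := latin_card N_gt0 (ufsS.1 L LS).
have [rho rhoP] := ufs_resolvable_array cardS ufsS.
have [M [Msym Minj Mlink]] := resolvable_array_linked cardT rhoP.
have c_inj := inj_comp (@cast_ord_inj _ _ cardT) (@enum_rank_inj T).
exists (fun i j x y => cast_ord cardT (enum_rank (M i j x y))).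
split=> [i j x y ij|i j x ij y z /c_inj|i j l x z ij jl il].
- by rewrite Msym.
- exact: Minj.
have [y0 [My0 uniq]] := Mlink i j l x z ij jl il.
by exists y0; split=> [|y]; rewrite ?My0 // -(uniq y) -(inj_eq c_inj).
Qed.

Unset Implicit Arguments.

Theorem theorem5p7 (g lam f : nat)
    (hGH : exists (G : finZmodType) (H : 'M[G]_(g * lam)), is_gen_hadamard H)
    (hUFS : exists (T : finType) (S : {set 'M[T]_(g * lam)}),
        #|S| = f /\ mutually_ufs_latin S) :
  exists A : 'I_f.+1 -> 'I_f.+1 -> 'M[int]_(g ^ 3 * lam ^ 2),
    is_linked_system (g ^ 2 * lam ^ 2) (g ^ 2 * lam ^ 2) g 0 (g * lam ^ 2)
      ((g%:Z + g%:Z * lam%:Z - 1) * lam%:Z)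
      ((g%:Z * lam%:Z - 1) * lam%:Z) A.
Proof.
have [G [H [cardG hadH]]] := hGH.
have [T [S [cardS ufsS]]] := hUFS.
have rowH : uniform_differences lam H.
  by move=> i k ik x; rewrite diff_count_card hadH.
have [M [Msym Minj Mlink]] := exists_linked_squares cardS ufsS.
have v_eq : (g ^ 3 * lam ^ 2 = g ^ 2 * lam ^ 2 * g)%N by ring.
have cardP : #|{: 'I_(g * lam) * 'I_(g * lam)}| = (g ^ 2 * lam ^ 2)%N.
  by rewrite card_prod card_ord; ring.
have [phi [phi_bij phi_group]] := group_mx_coord v_eq cardP cardG.
have mulE (F F' : 'I_(g * lam) * 'I_(g * lam) * G -> _ -> int) x y :
    ((\matrix_(x, y) F (phi x) (phi y) : 'M[int]_(g ^ 3 * lam ^ 2))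
     *m \matrix_(x, y) F' (phi x) (phi y)) x y =
    \sum_q F (phi x) q * F' q (phi y).
  rewrite mxE [RHS](reindex phi) /=; last exact: onW_bij.
  by apply: eq_bigr => z _; rewrite !mxE.
pose A i j : 'M[int]_(g ^ 3 * lam ^ 2) :=
  \matrix_(x, y) design_entry H (M i j) (phi x) (phi y).
have A_tr i j : i != j -> (A i j)^T = A j i.
  move=> ij; apply/matrixP => x y; rewrite !mxE; apply: design_entry_tr => a b.
  exact: Msym.
have A_gram i j : i != j -> A i j *m A j i =
    (g ^ 2 * lam ^ 2)%N%:Z *: 1%:M + 0%N%:Z *: (group_mx v_eq - 1%:M)
    + (g * lam ^ 2)%N%:Z *: (all_ones _ - group_mx v_eq).
  move=> ij; have ji : j != i by rewrite eq_sym.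
  apply/matrixP => x y; rewrite mulE (design_entry_mul_tr _ _ rowH); last 3 first.
  - by move=> a b; apply: Msym.
  - by move=> a; apply: Minj.
  - by move=> a; apply: Minj.
  rewrite scale0r addr0 !mxE phi_group (inj_eq (bij_inj phi_bij)).
  (* Within a group only the diagonal survives, with value [N * N]; across groups the value is
     [N * lam]. *)
  have [_|neq] := eqVneq (phi x).1 (phi y).1.
    by rewrite subrr mulr0 addr0 natz; congr (Posz _ * _); ring.
  have -> : (x == y) = false by apply: contraNF neq => /eqP->.
  by rewrite subr0 mulr0n mulr0 add0r mulr1 natz; congr (Posz _); ring.
exists A; split=> [i j ij|//|i j l ij jl il].
  exists v_eq; rewrite A_tr //; split=> [x y||].
  - by rewrite mxE /design_entry; case: eqP; [right|left].
  - exact: A_gram.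
  - by apply: A_gram; rewrite eq_sym.
apply/matrixP => x y; rewrite mulE.
have [y0 [My0 uniq]] := Mlink i j l (phi x).1.1 (phi y).1.1 ij jl il.
rewrite (design_entry_mul_link rowH My0 uniq) !mxE.
(* With [N = g * lam], the constants satisfy [sigma - tau = N] and [tau = (N - 1) * lam]. *)
by rewrite natrM; ring.
Qed.
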